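(* For any $s,\lambda,s_0\in(0,\infty)$ with $s\ne\lambda$, let $(s_k)_{k\ge0}$ be the sequence started at $s_0$ and defined by $$s_{k+1}=\frac{s^2s_k}{s_k(s+\lambda)+\lambda^2}.$$ Then there exists $c\in[0,1)$ such that, for all $k\ge0$, $$|s_{k+1}-(s-\lambda)^+|\le c\,|s_k-(s-\lambda)^+|,$$ and the iteration converges globally on $(0,\infty)$ to the softmax function, i.e. $s_k\to(s-\lambda)^+$ for every $s_0\in(0,\infty)$.
   Context: Here $(x)^+=\max\{0,x\}$. The constant $c$ may depend on $s,\lambda,s_0$ but not on $k$. *)

(* Defs.v *)
From mathcomp Require Import all_boot all_order all_algebra.
From mathcomp Require Import all_classical all_reals all_analysis.
Import Order.TTheory GRing.Theory Num.Theory.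
Import numFieldNormedType.Exports.

Set Implicit Arguments.
Unset Strict Implicit.
Unset Printing Implicit Defensive.

Local Open Scope ring_scope.

Definition pos_part (R : realType) (x : R) : R := Num.max 0 x.

Fixpoint sval_iter (R : realType) (s lambda s0 : R) (k : nat) : R :=
  if k is k'.+1 then
    let sk := sval_iter s lambda s0 k' in
    (s ^+ 2 * sk) / (sk * (s + lambda) + lambda ^+ 2)
  else s0.

(* Main.v *)
Require Import Defs.
From mathcomp Require Import all_boot all_order all_algebra.
From mathcomp Require Import all_classical all_reals all_analysis.
From mathcomp Require Import ring.
Import Order.TTheory GRing.Theory Num.Theory.
Import numFieldNormedType.Exports.

Local Open Scope classical_set_scope.
Local Open Scope ring_scope.

(** Write [a] for [pos_part (s - lambda)] and
    [f x = s ^+ 2 * x / (x * (s + lambda) + lambda ^+ 2)] for the iterated map.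
    Whatever the sign of [s - lambda], the point [a] is fixed by [f], and the
    deviation from it is multiplied by an explicit factor:
    [f x - a = min(s, lambda)^2 / (x * (s + lambda) + lambda ^+ 2) * (x - a)]
    (lemma [sval_step_subr]).  This factor decreases with [x], so along an
    orbit it is at most its value at any nonnegative lower bound of that orbit.
    The orbit of [s0] stays above [min(s0, a)] (lemma [sval_iter_ge]), and the
    factor at that bound is less than 1: if [s < lambda] it equals
    [s^2 / lambda^2], and if [lambda < s] the lower bound is positive, so the
    denominator exceeds [lambda^2].  Iterating the contraction gives geometric convergence. *)

Lemma sval_step_subr (R : realType) (s lambda x : R) :
    0 < x * (s + lambda) + lambda ^+ 2 ->
  s ^+ 2 * x / (x * (s + lambda) + lambda ^+ 2) - pos_part (s - lambda) =
  Num.min s lambda ^+ 2 / (x * (s + lambda) + lambda ^+ 2)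
    * (x - pos_part (s - lambda)).
Proof.
move=> /lt0r_neq0 D0; rewrite /pos_part.
have [sl|ls] := ltP s lambda.
  by rewrite max_l ?subr_le0 1?ltW//; field.
by rewrite max_r ?subr_ge0//; field.
Qed.

Lemma sval_den_gt0 (R : realType) (s lambda x : R) :
  0 < s -> 0 < lambda -> 0 <= x -> 0 < x * (s + lambda) + lambda ^+ 2.
Proof.
by move=> s0 l0 x0; rewrite ltr_wpDl ?exprn_gt0// mulr_ge0// addr_ge0 ?ltW.
Qed.

(** By induction on [k], with [x >= m] the previous iterate.  If
    [lambda < s], the claim [m <= f x] amounts to
    [m * lambda^2 <= (s^2 - m * (s + lambda)) * x], where the coefficient of
    [x] is at least [lambda^2] because [m <= s - lambda].  Otherwise [m] is 0
    and only the nonnegativity of the iterates is claimed. *)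
Lemma sval_iter_ge (R : realType) (s lambda s0 m : R) (k : nat) :
    0 < s -> 0 < lambda -> 0 <= m -> m <= pos_part (s - lambda) -> m <= s0 ->
  m <= sval_iter s lambda s0 k.
Proof.
move=> s_gt0 l_gt0 m0 ma ms0; elim: k => [//|k IHk] /=.
move: (sval_iter s lambda s0 k) IHk => x mx.
have x0 : 0 <= x by exact: le_trans mx.
have D0 : 0 < x * (s + lambda) + lambda ^+ 2 by exact: sval_den_gt0.
rewrite ler_pdivlMr//; move: ma; rewrite /pos_part.
have [sl|ls] := leP (s - lambda) 0 => ma.
  (* the limit is 0, which forces [m = 0] *)
  have -> : m = 0 by apply/eqP; rewrite eq_le ma.
  by rewrite mul0r mulr_ge0// sqr_ge0.
(* the excess [s^2 * x - m * (x * (s + lambda) + lambda^2)] is the sum of the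
   two products [h1] and [h2] *)
have h1 : 0 <= (s + lambda) * (s - lambda - m) * x.
  by rewrite !mulr_ge0 ?subr_ge0// addr_ge0 ?ltW.
have h2 : 0 <= lambda ^+ 2 * (x - m) by rewrite mulr_ge0 ?sqr_ge0 ?subr_ge0.
rewrite -subr_ge0; apply: le_trans (addr_ge0 h1 h2) _.
by rewrite le_eqVlt; apply/orP; left; apply/eqP; ring.
Qed.

Lemma sval_iter_contraction (R : realType) (s lambda s0 : R) :
    0 < s -> 0 < lambda -> 0 < s0 -> s != lambda ->
  exists2 c : R, 0 <= c < 1 &
    forall k : nat,
      `|sval_iter s lambda s0 k.+1 - pos_part (s - lambda)|
        <= c * `|sval_iter s lambda s0 k - pos_part (s - lambda)|.
Proof.
move=> s_gt0 l_gt0 s0_gt0 sl.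
pose m := Num.min s0 (pos_part (s - lambda)).
have m0 : 0 <= m by rewrite le_min ltW//= /pos_part le_max lexx.
have Dm0 : 0 < m * (s + lambda) + lambda ^+ 2 by exact: sval_den_gt0.
exists (Num.min s lambda ^+ 2 / (m * (s + lambda) + lambda ^+ 2)).
  apply/andP; split; first by rewrite divr_ge0 ?sqr_ge0 ?ltW.
  rewrite ltr_pdivrMr// mul1r; case: (ltgtP s lambda) sl => // [sl|ls] _.
    by rewrite ltr_wpDl ?mulr_ge0 ?addr_ge0 ?(ltW s_gt0) ?(ltW l_gt0)//
       ltr_pXn2r ?nnegrE ?ltW.
  (* here the limit [s - lambda], hence also [m], is positive *)
  by rewrite ltrDr mulr_gt0 ?addr_gt0// lt_min s0_gt0 /pos_part lt_max
     subr_gt0 ls orbT.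
move=> k.
have mk : m <= sval_iter s lambda s0 k.
  by apply: sval_iter_ge; rewrite // /m ge_min lexx ?orbT.
have Dk0 : 0 < sval_iter s lambda s0 k * (s + lambda) + lambda ^+ 2.
  by apply: sval_den_gt0 => //; exact: le_trans mk.
rewrite /= sval_step_subr// normrM ler_wpM2r// ger0_norm; last first.
  by rewrite divr_ge0 ?sqr_ge0 ?ltW.
rewrite ler_wpM2l ?sqr_ge0// lef_pV2 ?posrE// lerD2r ler_wpM2r//.
by rewrite addr_ge0 ?ltW.
Qed.

Lemma cvg_of_contraction (R : realType) (u : nat -> R) (a c : R) :
    0 <= c < 1 -> (forall k, `|u k.+1 - a| <= c * `|u k - a|) ->
  u @ \oo --> a.
Proof.
move=> /andP[c0 c1] uc.
have geo k : `|u k - a| <= `|u 0%N - a| * c ^+ k.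
  elim: k => [|k IHk]; first by rewrite expr0 mulr1.
  by rewrite (le_trans (uc k))// exprS mulrCA ler_wpM2l.
have geo0 : (fun k => `|u 0%N - a| * c ^+ k) @ \oo --> (0 : R).
  by apply: cvg_geometric; rewrite ger0_norm.
apply/subr_cvg0; apply: norm_cvg0.
apply: (squeeze_cvgr _ (cvg_cst (0 : R)) geo0).
by apply: nearW => k; rewrite normr_ge0 /=; exact: geo.
Qed.

Theorem lemma3p2 (R : realType) (s lambda s0 : R)
    (hs : 0 < s) (hlambda : 0 < lambda) (hs0 : 0 < s0) (hne : s != lambda) :
  (exists2 c : R, 0 <= c < 1 &
     forall k : nat,
       `|sval_iter s lambda s0 k.+1 - pos_part (s - lambda)|
         <= c * `|sval_iter s lambda s0 k - pos_part (s - lambda)|) /\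
  (forall t0 : R, 0 < t0 ->
     sval_iter s lambda t0 @ \oo --> pos_part (s - lambda)).
Proof.
split; first exact: sval_iter_contraction.
move=> t0 t0_gt0.
have [c c01 hc] := sval_iter_contraction _ _ _ _ hs hlambda t0_gt0 hne.
exact: cvg_of_contraction c01 hc.
Qed.
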